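(* Let $G$ be a finite abelian group with dual group $\widehat{G}$, let $A$ be a finite label set with $d=|A|$, and let $l\in\{-1,0,1,\dots,d\}$. Let $F=(f_\omega)_{\omega\in\{0,1\}^A}$ be an $A$-cube of functions $f_\omega:G\to\mathbb{C}$, and let $\widehat{F}=(\widehat{f}_\omega)_{\omega\in\{0,1\}^A}$ be the $A$-cube of their Fourier transforms. Then $$\langle F\rangle_{A,l}=\langle \widehat{F}\rangle_{A,d-l-1}.$$
   Context: $\widehat{G}$ is the group of characters $\chi:G\to\mathbb{C}^\times$, written additively ($(\chi+\psi)(x)=\chi(x)\psi(x)$, $0$ is the trivial character). The Fourier transform of $f:G\to\mathbb{C}$ is $\widehat{f}(\chi)=\mathbb{E}_{x\in G}f(x)\overline{\chi(x)}$, so $f=\sum_{\chi\in\widehat{G}}\widehat{f}(\chi)\chi$. For $\omega\in\{0,1\}^A$, $|\omega|=\sum_{j\in A}\omega_j$. For an abelian group $K$ (here $K=G$ or $K=\widehat{G}$), an $A$-cube in $K$ is a map $p:\{0,1\}^A\to K$, $p=(x_\omega)$; these form the group $K^{\{0,1\}^A}$ under pointwise addition. For $B\subseteq A$, writing $\omega=(\omega'',\eta)\in\{0,1\}^{A\setminus B}\times\{0,1\}^B$, define $\delta_B:K^{\{0,1\}^A}\to K^{\{0,1\}^{A\setminus B}}$ by $(\delta_Bp)(\omega'')=\sum_{\eta\in\{0,1\}^B}(-1)^{|\eta|}p(\omega'',\eta)$ ($\delta_\emptyset=\mathrm{id}$). For $-1\le l\le d-1$, the group of degree-$l$ $A$-cubes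 is $\mathcal{P}^{A,l}(K)=\bigcap_{B\subseteq A,\,|B|=l+1}\ker\delta_B$; for $l\ge d$, $\mathcal{P}^{A,l}(K)=K^{\{0,1\}^A}$. Let $\mathcal{C}$ denote complex conjugation and $\mathcal{C}^m$ its $m$-fold iterate. For an $A$-cube of functions $F=(f_\omega)$ on $G$, $\langle F\rangle_{A,l}=\mathbb{E}_{(x_\omega)\in\mathcal{P}^{A,l}(G)}\prod_{\omega\in\{0,1\}^A}\mathcal{C}^{|\omega|}f_\omega(x_\omega)$ (uniform average). For an $A$-cube of functions $\widehat{F}=(g_\omega)$ on $\widehat{G}$, $\langle \widehat{F}\rangle_{A,l}=\sum_{(\chi_\omega)\in\mathcal{P}^{A,l}(\widehat{G})}\prod_{\omega\in\{0,1\}^A}\mathcal{C}^{|\omega|}g_\omega(\chi_\omega)$. *)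

(* Defs.v *)
From HB Require Import structures.
From mathcomp Require Import all_boot all_order all_fingroup all_algebra cyclic.
From mathcomp Require Export reals complex.

Set Implicit Arguments.
Unset Strict Implicit.
Unset Printing Implicit Defensive.

Import Order.TTheory GRing.Theory Num.Theory.

Local Open Scope ring_scope.

Section Characters.
Variables (C : numClosedFieldType) (G : finZmodType).

Definition is_character (f : {ffun G -> C}) : bool :=
  [forall x, f x \is a GRing.unit] && [forall x, forall y, f (x + y) == f x * f y].

Record character := Character {
  character_fun :> {ffun G -> C};
  characterP : is_character character_fun }.

HB.instance Definition _ := [isSub for character_fun].
HB.instance Definition _ := [Choice of character by <:].

Lemma character_unit (chi : character) x : chi x \is a GRing.unit.
Proof. by have /andP[/forallP H _] := characterP chi; apply: H. Qed.

Lemma characterD (chi : character) x y : chi (x + y) = chi x * chi y.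
Proof. by have /andP[_ /'forall_'forall_eqP H] := characterP chi; apply: H. Qed.

Lemma character0 (chi : character) : chi 0 = 1.
Proof.
by apply: (mulrI (character_unit chi 0)); rewrite mulr1 -characterD addr0.
Qed.

Lemma characterMn (chi : character) x n : chi (x *+ n) = chi x ^+ n.
Proof.
elim: n => [|n IHn]; first by rewrite mulr0n expr0 character0.
by rewrite mulrS exprS characterD IHn.
Qed.

Lemma character_expr_card (chi : character) x : chi x ^+ #|G| = 1.
Proof.
by rewrite -characterMn -cardsT -FinRing.zmodXgE expg_cardG ?inE // character0.
Qed.

Lemma character_ext (chi psi : character) : chi =1 psi -> chi = psi.
Proof. by move=> H; apply/val_inj/ffunP. Qed.

(* The dual group is written additively, so its operations are the pointwise
   product and inverse of characters. *)
Fact triv_char_subproof : is_character [ffun=> 1].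
Proof.
apply/andP; split; first by apply/forallP => x; rewrite ffunE unitr1.
by apply/'forall_'forall_eqP => x y; rewrite !ffunE mulr1.
Qed.

Fact mul_char_subproof (chi psi : character) :
  is_character [ffun x => chi x * psi x].
Proof.
apply/andP; split.
  by apply/forallP => x; rewrite ffunE unitrM !character_unit.
by apply/'forall_'forall_eqP => x y; rewrite !ffunE !characterD mulrACA.
Qed.

Fact inv_char_subproof (chi : character) : is_character [ffun x => (chi x)^-1].
Proof.
apply/andP; split; first by apply/forallP => x; rewrite ffunE unitrV character_unit.
by apply/'forall_'forall_eqP => x y; rewrite !ffunE characterD invfM.
Qed.

Definition triv_char := Character triv_char_subproof.
Definition mul_char chi psi := Character (mul_char_subproof chi psi).
Definition inv_char chi := Character (inv_char_subproof chi).

Fact mul_charA : associative mul_char.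
Proof. by move=> a b c; apply: character_ext => x; rewrite !ffunE mulrA. Qed.

Fact mul_charC : commutative mul_char.
Proof. by move=> a b; apply: character_ext => x; rewrite !ffunE mulrC. Qed.

Fact mul_triv_char : left_id triv_char mul_char.
Proof. by move=> a; apply: character_ext => x; rewrite !ffunE mul1r. Qed.

Fact mul_inv_char : left_inverse triv_char inv_char mul_char.
Proof.
by move=> a; apply: character_ext => x; rewrite !ffunE mulVr ?character_unit.
Qed.

HB.instance Definition _ := GRing.isZmodule.Build character
  mul_charA mul_charC mul_triv_char mul_inv_char.

(* Finiteness: character values are #|G|-th roots of unity, so a character is
   determined by the positions of its values in a list of these roots. *)
Let unity_roots : seq C := sval (closed_field_poly_normal ('X^#|G| - 1 : {poly C})).

Let character_val (chi : character) x : chi x \in unity_roots.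
Proof.
have n_gt0 : (0 < #|G|)%N by apply/card_gt0P; exists 0.
rewrite /unity_roots; case: closed_field_poly_normal => r /= def_r.
have : root ('X^#|G| - 1) (chi x).
  by rewrite rootE !hornerE character_expr_card subrr.
by rewrite def_r (monicP (monicXnsubC 1 n_gt0)) scale1r root_prod_XsubC.
Qed.

Let char_code (chi : character) : {ffun G -> 'I_(size unity_roots).+1} :=
  [ffun x => inord (index (chi x) unity_roots)].

Let char_decode (h : {ffun G -> 'I_(size unity_roots).+1}) : option character :=
  insub [ffun x => unity_roots`_(h x)].

Fact char_codeK : pcancel char_code char_decode.
Proof.
move=> chi; rewrite /char_decode (_ : finfun _ = val chi) ?valK //.
apply/ffunP => x; rewrite !ffunE inordK ?nth_index ?character_val //.
by rewrite ltnS index_size.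
Qed.

HB.instance Definition _ := PCanIsCountable char_codeK.
HB.instance Definition _ : isFinite character := PCanIsFinite char_codeK.

Definition fourier (f : G -> C) (chi : character) : C :=
  #|G|%:R^-1 * \sum_(x : G) f x * (chi x)^*.

End Characters.

Section Cubes.

Definition vertex (A : finType) := {ffun A -> bool}.

Definition weight (A : finType) (w : vertex A) : nat := (\sum_(j : A) w j)%N.

Definition cube (A : finType) (K : Type) := {ffun vertex A -> K}.

(* The vertex (w, e) of {0,1}^A = {0,1}^(A \ B) x {0,1}^B. *)
Definition glue (A : finType) (B : {set A})
    (w : vertex {j : A | j \notin B}) (e : vertex {j : A | j \in B}) : vertex A :=
  [ffun j => match boolP (j \in B) with
             | AltTrue jB => e (exist _ j jB)
             | AltFalse jNB => w (exist _ j jNB)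
             end].

Definition delta (A : finType) (K : zmodType) (B : {set A}) (p : cube A K) :
    cube {j : A | j \notin B} K :=
  [ffun w => \sum_(e : vertex {j : A | j \in B}) p (glue w e) *~ (-1) ^+ weight e].

(* Meant for l >= -1: when l < -1 the intersection is over an empty family. *)
Definition degree_cubes (A : finType) (K : finZmodType) (l : int) : {set cube A K} :=
  if l < #|A|%:Z then
    \bigcap_(B : {set A} | #|B|%:Z == l + 1) [set p : cube A K | delta B p == 0]
  else [set: cube A K].

Definition cube_prod (C : numClosedFieldType) (A : finType) (K : Type)
    (F : vertex A -> K -> C) (p : cube A K) : C :=
  \prod_(w : vertex A) iter (weight w) Num.conj (F w (p w)).

Definition cube_mean (C : numClosedFieldType) (A : finType) (G : finZmodType)
    (F : vertex A -> G -> C) (l : int) : C :=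
  #|degree_cubes A G l|%:R^-1 * \sum_(p in degree_cubes A G l) cube_prod F p.

Definition cube_sum (C : numClosedFieldType) (A : finType) (G : finZmodType)
    (F : vertex A -> character C G -> C) (l : int) : C :=
  \sum_(p in degree_cubes A (character C G) l) cube_prod F p.

End Cubes.

(* Main.v *)
(** Pair a cube of characters with a cube of points by
    <chi, p> = prod_w C^|w| chi_w(p_w). Expanding each f_w by Fourier inversion
    reduces the theorem to Poisson summation over the subgroup P^{A,l}(G), i.e.
    to the claim that its annihilator is P^{A,d-l-1}(dual G). A cube has degree l
    iff its signed sums over all (l+1)-dimensional faces vanish. Evaluating such
    a face sum of chi at g is pairing chi with the cube equal to g on the face
    and 0 elsewhere, and this cube has degree l when the face has dimension d-l;
    this bounds the annihilator from above. Conversely, by Moebius inversion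
    p_w = sum_{u <= w} a_u, and <chi, p> = prod_u (S_u chi)(a_u), where S_u chi
    is the signed sum of chi over the face {w >= u}: if |u| > l then a_u = 0, and
    otherwise that face has dimension at least d-l, so S_u chi = 0. *)
Require Import Defs.
From mathcomp Require Import all_boot all_order all_fingroup all_algebra cyclic all_field.

Import Order.TTheory GRing.Theory Num.Theory.
Local Open Scope ring_scope.

(** * Characters separate points *)

(** In characteristic 0 the polynomial X^k - 1 is separable, and it annihilates [M]. *)
Lemma finite_order_diagonalizable (C : numClosedFieldType) n (M : 'M[C]_n.+1) k :
  (0 < k)%N -> M ^+ k = 1 -> diagonalizable M.
Proof.
move=> k_gt0 Mk1; have [rs rsE] := closed_field_poly_normal ('X^k - 1 : {poly C}).
rewrite (monicP (monicXnsubC 1 k_gt0)) scale1r in rsE.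
apply/diagonalizableP; exists rs.
  by rewrite -separable_prod_XsubC -rsE separable_Xn_sub_1 // pnatr_eq0 -lt0n.
rewrite -rsE; apply/mxminpoly_min.
by rewrite rmorphB rmorphXn /= horner_mx_X rmorph1 Mk1 subrr.
Qed.

Lemma exists_character (C : numClosedFieldType) (G : finZmodType) (x : G) :
  x != 0 -> exists chi : character C G, chi x != 1.
Proof.
move=> x_neq0.
have [n [f [f' fK f'K]]] : exists n, exists f : 'I_n.+1 -> G, bijective f.
  have nE : #|G|.-1.+1 = #|G| by rewrite prednK //; apply/card_gt0P; exists 0.
  exists #|G|.-1, (enum_val \o cast_ord nE).
  apply: bij_comp; first exact: enum_val_bij.
  by exists (cast_ord (esym nE)); [exact: cast_ordK|exact: cast_ordKV].
(* [M y] is the permutation matrix of translation by [y], in the basis of points of [G] enumerated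
   by [f]. *)
pose M y : 'M[C]_n.+1 := \matrix_(i, j) (f j == f i + y)%:R.
have MD y z : M (y + z) = M y * M z.
  apply/matrixP => i j; rewrite !mxE (bigD1 (f' (f i + y))) //= big1 => [|k ki].
    by rewrite !mxE f'K eqxx mul1r addr0 addrA.
  rewrite !mxE; case: eqP => [kE|_]; last by rewrite mul0r.
  by rewrite -kE fK eqxx in ki.
have M0 : M 0 = 1.
  by apply/matrixP => i j; rewrite !mxE addr0 (can_eq fK) eq_sym.
have MX y k : M y ^+ k = M (y *+ k).
  by elim: k => [|k IHk]; rewrite ?mulr0n // exprS IHk mulrS MD.
have order_y (y : G) : y *+ #|G| = 0.
  by rewrite -cardsT -FinRing.zmodXgE expg_cardG ?inE.
(* The regular representation of G is simultaneously diagonalizable; its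
   diagonal entries are characters, and they are not all 1 at x since the
   representation is faithful. *)
have /codiagonalizableP[P P_unit /allP P_diag] :
    {in codom M &, forall A B, comm_mx A B} /\ {in codom M, forall A, diagonalizable A}.
  split=> [_ _ /codomP[y ->] /codomP[z ->]|_ /codomP[y ->]].
    by rewrite /comm_mx -!/(_ * _) -!MD addrC.
  apply: (@finite_order_diagonalizable _ _ _ #|G|); last by rewrite MX order_y.
  by apply/card_gt0P; exists 0.
pose D y := P *m M y *m invmx P.
have DE y i j : i != j -> D y i j = 0.
  move=> ij; have /P_diag/(diagonalizable_forP _ P_unit) := codom_f M y.
  exact.
have DD y z : D (y + z) = D y *m D z.
  by rewrite /D MD !mulmxA mulmxKV.
have DiD i y z : D (y + z) i i = D y i i * D z i i.
  rewrite DD mxE (bigD1 i) //= big1 ?addr0 // => k ki.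
  by rewrite DE ?mul0r // eq_sym.
have D0 : D 0 = 1 by rewrite /D M0 mulmx1 mulmxV.
have chiP i : is_character [ffun y => D y i i].
  apply/andP; split.
    apply/forallP => y; rewrite ffunE; apply/unitrP; exists (D (- y) i i).
    by rewrite -!DiD addNr subrr D0 mxE eqxx.
  by apply/'forall_'forall_eqP => y z; rewrite !ffunE DiD.
have [i Di|D1] := pickP (fun i => D x i i != 1).
  by exists (Character (chiP i)); rewrite ffunE.
have : M x = 1.
  have D1' : D x = 1.
    apply/matrixP => i j; rewrite [RHS]mxE; case: eqVneq => [<-|ij].
      by apply/eqP; have := D1 i; case: eqP.
    exact: DE.
  have -> : M x = invmx P *m D x *m P by rewrite /D !mulmxA mulVmx // mul1mx mulmxKV.
  by rewrite D1' mulmx1 mulVmx.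
(* This entry is 1 in [M x] but 0 in the identity, because [x] is not 0. *)
move=> /matrixP/(_ (f' 0) (f' x)); rewrite !mxE !f'K add0r eqxx.
by rewrite (can_eq f'K) eq_sym (negPf x_neq0) => /eqP; rewrite oner_eq0.
Qed.

(** Reindexing by [h] multiplies the sum by [c]. All orthogonality relations below are instances of
    this. *)
Lemma sum_translate_eq0 (R : idomainType) (V : finType) (S : pred V) (phi : V -> R)
    (h : V -> V) (c : R) :
  injective h -> (forall p, S (h p) = S p) -> (forall p, phi (h p) = phi p * c) ->
  c != 1 -> \sum_(p | S p) phi p = 0.
Proof.
move=> h_inj Sh phiM c_neq1.
have : (\sum_(p | S p) phi p) * (c - 1) = 0.
  rewrite mulrBr mulr1 [X in _ - X](reindex_inj h_inj) /= mulr_suml.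
  by rewrite (eq_bigl _ _ Sh) (eq_bigr _ (fun p _ => phiM p)) subrr.
by move/eqP; rewrite mulf_eq0 subr_eq0 (negPf c_neq1) orbF => /eqP.
Qed.

(** * Orthogonality of characters and Fourier inversion *)

Section Duality.
Variables (C : numClosedFieldType) (G : finZmodType).
Implicit Types (chi : character C G) (x y : G).

Lemma character_add chi psi x : (chi + psi) x = chi x * psi x.
Proof. by rewrite ffunE. Qed.

Lemma character_zero x : (0 : character C G) x = 1.
Proof. by rewrite ffunE. Qed.

Lemma character_opp chi x : (- chi) x = (chi x)^-1.
Proof. by rewrite ffunE. Qed.

Lemma characterN chi x : chi (- x) = (chi x)^-1.
Proof.
by apply: (mulrI (character_unit chi x)); rewrite -characterD !subrr character0
  mulrV ?character_unit.
Qed.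

Lemma conj_character chi x : (chi x)^* = (chi x)^-1.
Proof.
have n_gt0 : (0 < #|G|)%N by apply/card_gt0P; exists 0.
rewrite invC_norm; suff -> : `|chi x| = 1 by rewrite expr1n invr1 mul1r.
apply/eqP; rewrite -(pexpr_eq1 n_gt0) // -normrX.
by rewrite character_expr_card normr1.
Qed.

Lemma character_sum chi (I : Type) (r : seq I) (P : pred I) (f : I -> G) :
  chi (\sum_(i <- r | P i) f i) = \prod_(i <- r | P i) chi (f i).
Proof. exact: (big_morph chi (characterD chi) (character0 chi)). Qed.

Lemma sum_character_apply (I : Type) (r : seq I) (P : pred I)
    (f : I -> character C G) x :
  (\sum_(i <- r | P i) f i) x = \prod_(i <- r | P i) f i x.
Proof.
exact: (big_morph (fun chi => chi x) (fun chi psi => character_add chi psi x)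
  (character_zero x)).
Qed.

Lemma sum_characters x : \sum_(chi : character C G) chi x = #|{: character C G}|%:R *+ (x == 0).
Proof.
case: eqVneq => [->|x_neq0].
  by rewrite (eq_bigr _ (fun chi _ => character0 chi)) sumr_const.
have [chi chi_x] := @exists_character C _ _ x_neq0.
apply: (sum_translate_eq0 _ _ _ _ _ _ (addIr chi) _ _ chi_x) => // psi.
exact: character_add.
Qed.

(** Double counting: in the sum of [chi x] over all pairs, summing over [chi] first leaves only
    [x = 0], while summing over [x] first leaves only the trivial character. *)
Lemma card_dual : #|{: character C G}|%:R = #|G|%:R :> C.
Proof.
transitivity (\sum_(x : G) \sum_(chi : character C G) chi x).
  rewrite (eq_bigr _ (fun x _ => sum_characters x)) (bigD1 0) //= eqxx mulr1n.
  by rewrite big1 ?addr0 // => x /negPf ->.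
rewrite exchange_big (bigD1 0) //= (eq_bigr _ (fun x _ => character_zero x)).
rewrite sumr_const big1 ?addr0 // => chi chi_neq0.
have [x chi_x|chi1] := pickP (fun x => chi x != 1); last first.
  case/eqP: chi_neq0; apply: character_ext => x.
  by rewrite character_zero; apply/eqP; have := chi1 x; case: eqP.
apply: (sum_translate_eq0 _ _ _ _ _ _ (addIr x) _ _ chi_x) => // y.
exact: characterD.
Qed.

Lemma fourier_inversion (f : G -> C) x :
  f x = \sum_(chi : character C G) fourier f chi * chi x.
Proof.
have n_neq0 : #|G|%:R != 0 :> C by rewrite pnatr_eq0 -lt0n; apply/card_gt0P; exists 0.
transitivity (#|G|%:R^-1 * \sum_y \sum_(chi : character C G) f y * chi (x - y)).
  under eq_bigr do rewrite -mulr_sumr sum_characters card_dual subr_eq0.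
  rewrite (bigD1 x) //= eqxx big1 => [|y yx].
    by rewrite addr0 mulr1n mulrCA mulVf ?mulr1.
  by rewrite eq_sym (negPf yx) mulr0.
rewrite exchange_big mulr_sumr; apply: eq_bigr => chi _.
rewrite -mulrA mulr_suml; congr (_ * _); apply: eq_bigr => y _.
by rewrite conj_character characterD characterN -mulrA [_ * chi x]mulrC.
Qed.

End Duality.

(** * Signed sums over faces and Moebius inversion on the discrete cube *)

Section Faces.
Variable A : finType.
Implicit Types (u v w : vertex A) (B : {set A}) (j : A).

Definition vertex_sign w : int := (-1) ^+ weight w.

(** [B] is the set of free directions; [v] matters only outside [B]. *)
Definition face B v : pred (vertex A) :=
  fun u => [forall j, (j \notin B) ==> (u j == v j)].

Lemma faceP B v u : reflect (forall j, j \notin B -> u j = v j) (face B v u).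
Proof.
by apply: (iffP forallP) => [H j|H j]; [move/(implyP (H j))/eqP|apply/implyP=> /H/eqP].
Qed.

Definition flip j u : vertex A := [ffun i => u i (+) (i == j)].

Lemma flipK j : involutive (flip j).
Proof. by move=> u; apply/ffunP => i; rewrite !ffunE -addbA addbb addbF. Qed.

Lemma vertex_sign_prod w : vertex_sign w = \prod_j (-1) ^+ (w j).
Proof. exact: expr_sum. Qed.

Lemma vertex_signK w : vertex_sign w * vertex_sign w = 1.
Proof. by rewrite /vertex_sign -expr2 sqrr_sign. Qed.

Lemma vertex_sign_flip j u : vertex_sign (flip j u) = - vertex_sign u.
Proof.
rewrite !vertex_sign_prod (bigD1 j) //= [in RHS](bigD1 j) //= -mulNr; congr (_ * _).
  by rewrite ffunE eqxx addbT; case: (u j).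
by apply: eq_bigr => i ij; rewrite ffunE (negPf ij) addbF.
Qed.

Lemma sum_vertex_sign_eq0 (P : pred (vertex A)) j :
  (forall u, P (flip j u) = P u) -> \sum_(u | P u) vertex_sign u = 0.
Proof.
move=> Pflip; apply/eqP; rewrite -eqNr -sumrN.
rewrite [X in _ == X](reindex_inj (inv_inj (flipK j))) /= (eq_bigl _ _ Pflip).
by apply/eqP/eq_bigr => u _; rewrite vertex_sign_flip.
Qed.

Lemma flip_face j B v u : j \in B -> face B v (flip j u) = face B v u.
Proof.
move=> jB; apply: eq_forallb => i; case: (boolP (i \in B)) => //= iB.
rewrite ffunE; suff -> : (i == j) = false by rewrite addbF.
by apply: contraNF iB => /eqP ->.
Qed.

Section FaceSums.
Variable K : zmodType.
Implicit Type p : vertex A -> K.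

Definition face_sum B v p : K := \sum_(u | face B v u) p u *~ vertex_sign u.

Lemma face_sum_split j B v p : j \in B ->
  face_sum B v p = \sum_(b : bool) face_sum (B :\ j) [ffun i => if i == j then b else v i] p.
Proof.
move=> jB; rewrite /face_sum (partition_big (fun u => u j) xpredT) //=.
apply: eq_bigr => b _; apply: eq_bigl => u; apply/andP/faceP => [[/faceP uv /eqP uj] i|uv].
  rewrite !inE negb_and negbK ffunE; case: eqVneq => [-> _ //|ij /=].
  exact: uv.
split; last by have := uv j; rewrite !inE ffunE eqxx => /(_ isT)/eqP.
apply/faceP => i iB; have := uv i; rewrite !inE (negPf iB) andbF => /(_ isT).
by rewrite ffunE ifN //; apply: contraNneq iB => ->.
Qed.

(** Cutting along a free direction splits a face into two parallel faces of dimension one less, so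
    induction on the excess over [k] applies. *)
Lemma face_sum_eq0_le k p :
  (forall B v, #|B| = k -> face_sum B v p = 0) ->
  forall B v, (k <= #|B|)%N -> face_sum B v p = 0.
Proof.
move=> p0 B v /subnKC; move: (_ - k)%N => n; elim: n B v => [|n IHn] B v.
  by rewrite addn0 => /esym; exact: p0.
rewrite addnS => Bcard; have /card_gt0P[j jB] : (0 < #|B|)%N by rewrite -Bcard.
rewrite (@face_sum_split j) // big1 // => b _; apply: IHn.
by apply/eqP; rewrite -eqSS Bcard (cardsD1 j B) jB.
Qed.

Lemma face_sumD B v p q :
  face_sum B v (fun w => p w + q w) = face_sum B v p + face_sum B v q.
Proof. by rewrite -big_split; apply: eq_bigr => u _; exact: mulrzDl. Qed.

Definition support_set w : {set A} := [set j | w j].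

Definition moebius p w : K :=
  \sum_(u : vertex A | [forall j, u j ==> w j]) p u *~ (vertex_sign u * vertex_sign w).

(** The vertices below [w] form a face of dimension |w|, so low degree kills the coefficients at
    heavy vertices. *)
Lemma moebiusE p w :
  moebius p w = face_sum (support_set w) [ffun=> false] p *~ vertex_sign w.
Proof.
rewrite mulrz_suml; apply: eq_big => [u|u _]; last exact: mulrzA.
by apply: eq_forallb => j; rewrite !inE ffunE; case: (u j) (w j) => [] [].
Qed.

(** After exchanging sums, [p t] is weighted by the signed count of the interval from [t] to [w].
    For [t] different from [w], flipping a coordinate where they differ cancels it. *)
Lemma moebius_inversion p w : p w = \sum_(u : vertex A | [forall j, u j ==> w j]) moebius p u.
Proof.
rewrite (exchange_big_dep xpredT) //=.
under eq_bigr => t _.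
  under eq_bigr do rewrite mulrzA.
  rewrite -mulrz_sumr.
  over.
rewrite (bigD1 w) //= [X in _ + X]big1 => [|t tw].
  rewrite (big_pred1 w) => [|u].
    by rewrite -mulrzA vertex_signK addr0.
  apply/andP/eqP => [[/forallP uw /forallP wu]|->].
    apply/ffunP => j; apply/idP/idP; first exact: (implyP (uw j)).
    exact: (implyP (wu j)).
  by split; apply/forallP => j; apply: implybb.
have [j tj|tE] := pickP (fun j => t j != w j); last first.
  by case/eqP: tw; apply/ffunP => j; apply/eqP; have := tE j; case: eqP.
rewrite (@sum_vertex_sign_eq0 _ j) // => u.
have flipE i : i != j -> flip j u i = u i by move=> ij; rewrite ffunE (negPf ij) addbF.
(* If [t] is 1 and [w] is 0 at [j], the interval is empty and flip invariance is trivial. *)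
have wtF u' : (w j < t j)%N -> [forall i, u' i ==> w i] && [forall i, t i ==> u' i] = false.
  move=> wt; apply/negP => /andP[/forallP/(_ j) + /forallP/(_ j)].
  by case: (w j) (t j) (u' j) wt => [] [] [].
have [wt|tw'] := ltnP (w j) (t j); first by rewrite !wtF.
have {tj tw'} [tj wj] : t j = false /\ w j = true by case: (t j) (w j) tj tw' => [] [].
congr (_ && _); apply: eq_forallb => i; have [->|ij] := eqVneq i j.
- by rewrite wj !implybT.
- by rewrite flipE.
- by rewrite tj.
- by rewrite flipE.
Qed.

End FaceSums.
End Faces.

(** * The degree condition in terms of faces *)

Section DegreeCubes.
Variable A : finType.
Implicit Types (B : {set A}).

Lemma glue_in B w e (s : {j : A | j \in B}) : @glue A B w e (val s) = e s.
Proof.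
rewrite ffunE; destruct (boolP _) as [sB|sB]; last by case/negP: (sB); exact: valP.
by congr (e _); apply: val_inj.
Qed.

Lemma glue_notin B w e (s : {j : A | j \notin B}) : @glue A B w e (val s) = w s.
Proof.
rewrite ffunE; destruct (boolP _) as [sB|sB]; first by case/negP: (valP s).
by congr (w _); apply: val_inj.
Qed.

Lemma weight_glue B w e : weight (@glue A B w e) = (weight w + weight e)%N.
Proof.
rewrite /weight (bigID (mem B)) /= addnC; congr (_ + _)%N.
  rewrite (big_sub (fun j => j \notin B)) /=.
  by apply: eq_bigr => s _; rewrite glue_notin.
by rewrite (big_sub (mem B)) /=; apply: eq_bigr => s _; rewrite glue_in.
Qed.

(** [delta] counts only the signs inside [B]; the remaining sign, that of [w], is constant on the
    face. The choice of [e0] only picks a base vertex. *)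
Lemma delta_face_sum (K : zmodType) B (p : cube A K) w e0 :
  delta B p w *~ vertex_sign _ w = face_sum A K B (glue w e0) p.
Proof.
rewrite ffunE mulrz_suml /face_sum.
rewrite [RHS](reindex_onto (glue w) (fun u => [ffun s => u (val s)])) /=; last first.
  move=> u /faceP uw; apply/ffunP => j; case: (boolP (j \in B)) => jB.
    by rewrite (glue_in B _ _ (exist _ j jB)) ffunE.
  by rewrite uw // !(glue_notin B _ _ (exist _ j jB)).
apply: eq_big => [e|e _].
  apply/esym/andP; split; first apply/faceP => j jB.
    by rewrite !(glue_notin B _ _ (exist _ j jB)).
  by apply/eqP/ffunP => s; rewrite ffunE glue_in.
by rewrite -mulrzA /vertex_sign -exprD weight_glue addnC.
Qed.

Lemma delta_eq0P (K : zmodType) B (p : cube A K) :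
  reflect (forall v, face_sum A K B v p = 0) (delta B p == 0).
Proof.
apply: (iffP eqP) => [dp v|p0].
  suff -> : v = glue [ffun s => v (val s)] [ffun s : {j | j \in B} => v (val s)].
    by rewrite -delta_face_sum dp ffunE mul0rz.
  apply/ffunP => j; case: (boolP (j \in B)) => jB.
    by rewrite (glue_in B _ _ (exist _ j jB)) ffunE.
  by rewrite (glue_notin B _ _ (exist _ j jB)) ffunE.
apply/ffunP => w; rewrite [RHS]ffunE -[LHS]mulr1z -(vertex_signK _ w) mulrzA.
by rewrite (delta_face_sum _ _ _ _ [ffun=> false]) p0 mul0rz.
Qed.

Lemma degree_cubesP (K : finZmodType) (k : nat) (p : cube A K) :
  reflect (forall B v, #|B| = k -> face_sum A K B v p = 0)
    (p \in degree_cubes A K (k%:Z - 1)).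
Proof.
rewrite /degree_cubes; case: ltP => [_|dk].
  apply: (iffP bigcapP) => [pk B v Bk|pk B].
    by have := pk B; rewrite Bk subrK eqxx inE => /(_ isT)/delta_eq0P.
  by rewrite subrK eqz_nat inE => /eqP Bk; apply/delta_eq0P => v; exact: pk.
(* Here [k] exceeds [#|A|], so no [B] has [k] elements and the face condition is vacuous. *)
rewrite inE; apply: ReflectT => B v Bk; move: dk (max_card B).
by rewrite -Bk lerBrDr -PoszD lez_nat addn1 ltnNge => /negPf ->.
Qed.

Definition face_cube (K : zmodType) B (v : vertex A) (g : K) : cube A K :=
  [ffun u => g *+ face A B v u].

(* Two faces with more than #|A| free directions in total share a free
   direction, and flipping it cancels the signs on their intersection. *)
Lemma face_cube_degree (K : finZmodType) B v (g : K) k :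
  (#|B| + k = #|A|.+1)%N -> face_cube K B v g \in degree_cubes A K (k%:Z - 1).
Proof.
move=> Bk; apply/degree_cubesP => B' v' B'k.
have [j jB jB'] : exists2 j, j \in B & j \in B'.
  have [disj|/pred0Pn[j /andP[]]] := boolP [disjoint B & B']; last by exists j.
  have := max_card (mem (B :|: B')); have [_] := leq_card_setU B B'.
  by rewrite disj => /eqP ->; rewrite B'k Bk ltnn.
transitivity (g *~ \sum_(u | face A B v u && face A B' v' u) vertex_sign A u).
  rewrite mulrz_sumr /face_sum [RHS]big_mkcondl; apply: eq_bigr => u _.
  by rewrite ffunE; case: (face A B v u); rewrite ?mulr1n // mulr0n mul0rz.
by rewrite (sum_vertex_sign_eq0 _ _ j) ?mulr0z // => u; rewrite !flip_face.
Qed.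

End DegreeCubes.

(** * The pairing of cubes and annihilators of degree cubes *)

Section Pairing.
Variables (C : numClosedFieldType) (G : finZmodType) (A : finType).
Implicit Types (chi : cube A (character C G)) (p q : cube A G).

Definition pairing chi p : C := cube_prod (fun w x => chi w x) p.

(** Each conjugation inverts a character value, that is, negates its argument. *)
Lemma iter_conj_character (psi : character C G) w x :
  iter (weight w) Num.conj (psi x) = psi (x *~ vertex_sign A w).
Proof.
rewrite /vertex_sign; elim: (weight w) => [|n IHn] //=.
by rewrite IHn exprS mulN1r mulrNz characterN conj_character.
Qed.

Lemma character_applyMz_sign (psi : character C G) w x :
  psi (x *~ vertex_sign A w) = (psi *~ vertex_sign A w) x.
Proof.
rewrite /vertex_sign -signr_odd; case: (odd _) => //=.
by rewrite expr1 !mulrN1z character_opp characterN.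
Qed.

Lemma pairingE chi p : pairing chi p = \prod_w chi w (p w *~ vertex_sign A w).
Proof. by apply: eq_bigr => w _; exact: iter_conj_character. Qed.

Lemma pairingD chi p q : pairing chi [ffun w => p w + q w] = pairing chi p * pairing chi q.
Proof.
rewrite !pairingE -big_split; apply: eq_bigr => w _.
by rewrite ffunE mulrzDl characterD.
Qed.

Lemma pairing_face_cube chi B v g :
  pairing chi (face_cube A G B v g) = (face_sum A _ B v chi) g.
Proof.
rewrite pairingE sum_character_apply [RHS]big_mkcond; apply: eq_bigr => w _.
rewrite ffunE -character_applyMz_sign; case: (face A B v w) => //.
by rewrite mulr0n mul0rz character0.
Qed.

(** Expanding each [p w] and exchanging products, the coefficient at [u] meets every [chi w] with
    [w] above [u]; these [w] form the face through the all-ones vertex that is free off the support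
    of [u]. *)
Lemma pairing_moebius chi p :
  pairing chi p =
  \prod_u face_sum A _ (~: support_set A u) [ffun=> true] chi (moebius A G p u).
Proof.
rewrite pairingE.
under eq_bigr do rewrite (moebius_inversion _ _ p) character_applyMz_sign character_sum.
rewrite (exchange_big_dep xpredT) //=; apply: eq_bigr => u _.
rewrite sum_character_apply; apply: eq_bigl => w.
by apply: eq_forallb => j; rewrite !inE negbK ffunE eqb_id.
Qed.

(** With k = l + 1 and m = d - l the two degrees are l and d - l - 1. *)
Lemma degree_cubes_annihilator k m chi : (k + m = #|A|.+1)%N ->
  reflect (forall p, p \in degree_cubes A G (k%:Z - 1) -> pairing chi p = 1)
    (chi \in degree_cubes A (character C G) (m%:Z - 1)).
Proof.
move=> km; apply: (iffP (degree_cubesP _ _ _ _)) => [chi0 p /degree_cubesP p0|chi1 B v Bm].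
  rewrite pairing_moebius big1 // => u _.
  have [ku|uk] := leqP k #|support_set A u|.
    by rewrite moebiusE (face_sum_eq0_le _ _ _ _ p0) // mul0rz character0.
  rewrite (face_sum_eq0_le _ _ _ _ chi0) ?character_zero //.
  by rewrite -(leq_add2l #|support_set A u|) cardsC -ltnS -km ltn_add2r.
apply: character_ext => g; rewrite -pairing_face_cube character_zero.
by apply: chi1; apply: face_cube_degree; rewrite Bm addnC.
Qed.

Lemma sum_pairing k m chi : (k + m = #|A|.+1)%N ->
  \sum_(p in degree_cubes A G (k%:Z - 1)) pairing chi p =
  #|degree_cubes A G (k%:Z - 1)|%:R *+ (chi \in degree_cubes A _ (m%:Z - 1)).
Proof.
move=> km; case: (degree_cubes_annihilator k m chi km) => [chi1|chi1].
  by rewrite (eq_bigr _ chi1) sumr_const.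
(* Off the annihilator some [h] in the subgroup pairs nontrivially with [chi], and translation by
   [h] kills the sum. *)
have [h /andP[hk chi_h]|all1] :=
    pickP (fun h => (h \in degree_cubes A G (k%:Z - 1)) && (pairing chi h != 1)).
  apply: (sum_translate_eq0 _ _ _ _ (fun p => [ffun w => p w + h w]) _ _ _ _ chi_h) => [p q /ffunP pq|p|p].
  - by apply/ffunP => w; have := pq w; rewrite !ffunE => /addIr.
  - have hsum B v : face_sum A _ B v [ffun w => p w + h w] =
                    face_sum A _ B v p + face_sum A _ B v h.
      by rewrite -face_sumD; apply: eq_bigr => u _; rewrite ffunE.
    move/degree_cubesP: hk => hk.
    by apply/degree_cubesP/degree_cubesP => pk B v Bk; have := pk B v Bk;
      rewrite hsum hk // addr0.
  - exact: pairingD.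
case: chi1 => p pk; apply/eqP; have := all1 p; rewrite pk /=.
by case: eqP.
Qed.

End Pairing.

(** * Fourier expansion of cube products and Poisson summation *)

Lemma iter_conjM (C : numClosedFieldType) n (a b : C) :
  iter n Num.conj (a * b) = iter n Num.conj a * iter n Num.conj b.
Proof. by elim: n => //= n ->; rewrite rmorphM. Qed.

Lemma iter_conj_sum (C : numClosedFieldType) n (I : finType) (f : I -> C) :
  iter n Num.conj (\sum_i f i) = \sum_i iter n Num.conj (f i).
Proof. by elim: n => //= n ->; rewrite rmorph_sum. Qed.

Lemma cube_prod_fourier (C : numClosedFieldType) (G : finZmodType) (A : finType)
    (F : vertex A -> G -> C) (p : cube A G) :
  cube_prod F p =
  \sum_(chi : cube A (character C G)) cube_prod (fun w => fourier (F w)) chi * pairing C G A chi p.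
Proof.
transitivity (\prod_w \sum_(psi : character C G)
    iter (weight w) Num.conj (fourier (F w) psi) * iter (weight w) Num.conj (psi (p w))).
  apply: eq_bigr => w _; rewrite (fourier_inversion _ _ (F w) (p w)) iter_conj_sum.
  by apply: eq_bigr => psi _; exact: iter_conjM.
by rewrite bigA_distr_bigA; apply: eq_bigr => chi _; exact: big_split.
Qed.

Theorem theorem4p5 (R : realType) (G : finZmodType) (A : finType) (l : int)
    (hl : -1 <= l <= #|A|%:Z) (F : vertex A -> G -> R[i]) :
  cube_mean F l = cube_sum (fun w => fourier (F w)) (#|A|%:Z - l - 1).
Proof.
have [k [m [-> -> km]]] : exists k m : nat,
    [/\ l = k%:Z - 1, #|A|%:Z - l = m%:Z & (k + m = #|A|.+1)%N].
  case/andP: hl => l_ge l_le; exists (absz (l + 1)), (absz (#|A|%:Z - l)).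
  have k_ge : 0 <= l + 1 by rewrite -lerBlDr sub0r.
  have m_ge : 0 <= #|A|%:Z - l by rewrite subr_ge0.
  rewrite !gez0_abs // addrK; split=> //; apply/eqP.
  by rewrite -eqz_nat PoszD !gez0_abs // [_ + 1]addrC addrACA subrr addr0 -addn1 PoszD addrC.
(* The zero cube has every degree, so the normalising factor is invertible. *)
have H_neq0 : #|degree_cubes A G (k%:Z - 1)|%:R != 0 :> R[i].
  rewrite pnatr_eq0 -lt0n; apply/card_gt0P; exists [ffun=> 0].
  apply/degree_cubesP => B v _; apply: big1 => u _.
  by rewrite ffunE mul0rz.
rewrite /cube_mean (eq_bigr _ (fun p _ => cube_prod_fourier _ _ _ F p)).
rewrite exchange_big mulr_sumr /cube_sum [RHS]big_mkcond; apply: eq_bigr => chi _.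
(* The inner sum is the order of the subgroup when [chi] annihilates it and 0 otherwise; that order
   cancels the normalisation. *)
rewrite -mulr_sumr (sum_pairing _ _ _ k m) // mulrCA.
by case: ifP => _; rewrite ?mulVf ?mulr1 // mulr0n !mulr0.
Qed.
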